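(* Let $K$ be a number field of degree $n$ over $\mathbb{Q}$, let $\Delta(u_1,\dots,u_n)$ be the primitive form whose square is the discriminant of the fundamental equation of $K$ freed from its numerical factor, and let $p$ be any rational prime. Denote by $P_{k_1},P_{k_2},\dots,P_{k_l}$ the divisor systems of the form $P_k$ ($k\ge1$) which $\Delta$ contains, chosen by keeping only those whose index $k$ does not properly divide the index of another divisor system contained in $\Delta$ (so that none of $k_1,\dots,k_l$ is a multiple of another). Put, for a positive integer $x$, $$F(x)=(x^{k_1}-1)(x^{k_2}-1)\cdots(x^{k_l}-1),$$ and let $\nu$ be the smallest prime different from $p$ which does not divide the integer $F(p)$. Then: 1. The field $\Gamma_\nu$ of the $\nu$-th roots of unity is the smallest cyclotomic field of prime order which is a supplementary domain for $K$ with respect to $p$: $\Gamma_\nu$ is a supplementary domain, and for no prime $\nu_1<\nu$ is the field $\Gamma_{\nu_1}$ of $\nu_1$-th roots of unity a supplementary domain. 2. If $\mu$ is the largest divisor of $\nu-1$ for which $F(p^\mu)$ is not divisible by $\nu$, and $\lambda\mu=\nu-1$, then the subfield $\Gamma_\nu(\lambda)$ of $\Gamma_\nu$ defined by the $\lambda$ periods of $\mu$ terms of the $\nu$-th roots of unity is the smallest subfield of $\Gamma_\nu$ which is still a supplementary domain for $K$ with respect to $p$: it is a supplementary domain, and no subfield of $\Gamma_\nu$ of degree smaller than $\lambda$ is.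
   Context: Let $\xi_1,\dots,\xi_n$ be an integral basis of the ring of integers of $K$, $u_1,\dots,u_n$ indeterminates, $w_0=u_1\xi_1+\cdots+u_n\xi_n$ the fundamental form and $w_0,\dots,w_{n-1}$ its conjugates (replace the $\xi_i$ by their conjugates under the $n$ embeddings of $K$). The discriminant of the fundamental equation $\prod_j(w-w_j)=0$ is $\Delta(u_1,\dots,u_n)^2\cdot D$, where $D$ is the discriminant of $K$ (the numerical factor) and $\Delta$ is a homogeneous polynomial of degree $\frac{n(n-1)}2$ with integer coefficients having no common divisor (defined up to sign). For a number field $\Gamma$ with ring of integers $\mathcal{O}_\Gamma$, $\Gamma$ is a supplementary domain for $K$ with respect to the prime $p$ if values $a_1,\dots,a_n\in\mathcal{O}_\Gamma$ can be chosen for $u_1,\dots,u_n$ so that the discriminant $\Delta(a_1,\dots,a_n)^2D$ contains $p$ no more than the discriminant $D$ of $K$ does; equivalently, so that $\Delta(a_1,\dots,a_n)$ is coprime to $p$ in $\mathcal{O}_\Gamma$ (lies in no prime ideal dividing $p$). For $k\ge1$, $P_k=(p;\,u_1^{p^k}-u_1,\dots,u_n^{p^k}-u_n)$. A polynomial in $\mathbb{Z}[u_1,\dots,u_n]$ contains the divisor system $P_k$ if it lies in the ideal of $\mathbb{Z}[u_1,\dots,u_n]$ generated by $p,\,u_1^{p^k}-u_1,\dots,u_n^{p^k}-u_n$. Only finitely many $P_k$ are contained in $\Delta$, and if $\Delta$ contains $P_k$, then it contains $P_d$ for every divisor $d$ of $k$. For a prime $\nu$ and $\nu-1=\lambda\mu$,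 the $\lambda$ periods of $\mu$ terms are the Gaussian periods $\sum_{a\in C}\zeta^a$, with $\zeta$ a primitive $\nu$-th root of unity and $C$ running over the cosets of the subgroup of order $\mu$ in $(\mathbb{Z}/\nu\mathbb{Z})^\times$; $\Gamma_\nu(\lambda)$ is the unique subfield of $\Gamma_\nu=\mathbb{Q}(\zeta)$ of degree $\lambda$ over $\mathbb{Q}$.
   Formalization: The claim that no smaller Γ_{ν₁} is supplementary is proved except when p = 2 and Δ contains no P_k; there it is false: ν = 3 but Γ_2 = ℚ is already supplementary (e.g. K = ℚ, Δ = 1). *)

(* Defs.v *)
From HB Require Import structures.
From mathcomp Require Import all_boot all_order all_fingroup all_algebra all_field.
From mathcomp Require Import mpoly.

Set Implicit Arguments.
Unset Strict Implicit.
Unset Printing Implicit Defensive.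

Import GRing.Theory Num.Theory.
Local Open Scope ring_scope.

(* A number field is a [fieldExtType rat]; its degree is [\dim {:K}]. *)

Definition algint (L : fieldExtType rat) (x : L) : Prop :=
  integralOver (intr : int -> L) x.

Definition integral_basis (K : fieldExtType rat) (n : nat) (xi : 'I_n -> K) : Prop :=
  (forall i, algint (xi i)) /\
  (forall x : K, algint x ->
     exists! c : {ffun 'I_n -> int}, x = \sum_i (c i)%:~R * xi i).

(* [sigma] lists every embedding of [K] in the algebraic closure of Q exactly
   once. *)
Definition all_embeddings (K : fieldExtType rat) (n : nat)
    (sigma : 'I_n -> {rmorphism K -> algC}) : Prop :=
  (forall i j, sigma i =1 sigma j -> i = j) /\
  (forall f : {rmorphism K -> algC}, exists i, f =1 sigma i).

Section FundamentalEquation.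

Variables (K : fieldExtType rat) (n : nat).
Variables (xi : 'I_n -> K) (sigma : 'I_n -> {rmorphism K -> algC}).

Definition fundamental_form (j : 'I_n) : {mpoly algC[n]} :=
  \sum_(i < n) sigma j (xi i) *: 'X_i.

(* The discriminant of the polynomial \prod_j (w - w_j) in w. *)
Definition fundamental_disc : {mpoly algC[n]} :=
  \prod_(i < n) \prod_(j < n | (i < j)%N)
    (fundamental_form i - fundamental_form j) ^+ 2.

Definition field_disc : algC :=
  (\det (\matrix_(i < n, j < n) sigma j (xi i))) ^+ 2.

Definition index_form (Delta : {mpoly int[n]}) : Prop :=
  [/\ Delta \is 'C(n, 2).-homog,
      (forall d : int, (forall m : 'X_{1..n}, (d %| Delta@_m)%Z) -> `|d|%N = 1%N)
    & fundamental_disc = field_disc *: (map_mpoly intr Delta) ^+ 2].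

End FundamentalEquation.

Definition contains_system (n : nat) (Delta : {mpoly int[n]}) (p k : nat) : Prop :=
  exists (c : {mpoly int[n]}) (q : 'I_n -> {mpoly int[n]}),
    Delta = c * p%:R + \sum_(i < n) q i * ('X_i ^+ (p ^ k) - 'X_i).

(* The indices of the divisor systems contained in [Delta] that are maximal for
   divisibility, each listed once. *)
Definition maximal_systems (n : nat) (Delta : {mpoly int[n]}) (p : nat)
    (ks : seq nat) : Prop :=
  uniq ks /\
  (forall k : nat, k \in ks <->
     [/\ (0 < k)%N, contains_system Delta p k
       & forall k', (0 < k')%N -> contains_system Delta p k' ->
           (k %| k')%N -> k' = k]).

(* The truncated subtraction is exact for positive [x]. *)
Definition Fval (ks : seq nat) (x : nat) : nat := (\prod_(k <- ks) (x ^ k - 1))%N.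

(* Prime ideals of the ring of integers of [L], as subsets of [L]. *)
Definition prime_ideal (L : fieldExtType rat) (P : L -> Prop) : Prop :=
  [/\ forall x, P x -> algint x,
      P 0 /\ (forall x y, P x -> P y -> P (x + y)),
      forall x y, algint x -> P y -> P (x * y),
      ~ P 1
    & forall x y, algint x -> algint y -> P (x * y) -> P x \/ P y].

(* "The discriminant contains p no more than D does" is taken in its ideal-theoretic
   form: [Delta(a)] lies in no prime ideal dividing [p]. *)
Definition supplementary (n : nat) (Delta : {mpoly int[n]}) (p : nat)
    (L : fieldExtType rat) : Prop :=
  exists2 a : 'I_n -> L, (forall i, algint (a i)) &
    forall P : L -> Prop, prime_ideal P -> P p%:R ->
      ~ P ((map_mpoly intr Delta).@[a]).

(* [L] is the field of [nu]-th roots of unity, generated by [zeta]. *)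
Definition cyclotomic_field (nu : nat) (L : fieldExtType rat) (zeta : L) : Prop :=
  nu.-primitive_root zeta /\ <<1; zeta>>%VS = fullv.

Section Periods.

Variables (nu : nat) (L : fieldExtType rat) (zeta : L).

Definition gauss_period (C : {set {unit 'F_nu}}) : L :=
  \sum_(a in C) zeta ^+ (val a : 'F_nu).

(* The field defined by the periods attached to the cosets of [H]. *)
Definition period_field (H : {group {unit 'F_nu}}) : {subfield L} :=
  <<1 & [seq gauss_period C | C <- enum (rcosets H [set: {unit 'F_nu}])]>>%AS.

End Periods.

(* Main.v *)
Require Import Defs.
From Stdlib Require Import Classical ClassicalEpsilon.
From HB Require Import structures.
From mathcomp Require Import all_boot all_order all_fingroup all_algebra all_solvable all_field.
From mathcomp Require Import mpoly zify.

Set Implicit Arguments.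
Unset Strict Implicit.
Unset Printing Implicit Defensive.

Import GRing.Theory Num.Theory.
Local Open Scope ring_scope.

(** The ring of integers of Q(zeta), zeta a primitive nu-th root of unity with nu
    prime, is Z[zeta] ([algint_cyclotomic]).  Integers of a subfield L of Q(zeta)
    can therefore be written g(zeta) with g in Z[X], and reduced modulo a prime
    over p by evaluating g at a root omega of 1 + X + ... + X^(nu-1) in a field of
    characteristic p; irreducibility of this polynomial makes the reduction well
    defined.  Frobenius becomes explicit: g(omega)^(p^k) = g(omega^(p^k)).

    Non-supplementary fields ([not_supplementary]).  If Delta contains P_k and
    x^(p^k) = x holds in the residue field, then Delta(a) reduces to 0 for all a,
    so Delta(a) lies in the prime ideal which is the kernel of the reduction.  This
    happens for Q(zeta_nu1) when nu1 divides p^k - 1, when nu1 = p (take omega = 1),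
    and for a subfield E of Q(zeta_nu) when nu divides (p^k)^[Q(zeta_nu) : E] - 1:
    the Galois group of Q(zeta_nu) over E is the subgroup of order [Q(zeta_nu) : E]
    of the cyclic group of units modulo nu, so zeta -> zeta^(p^k) fixes E
    ([zeval_fixed_subfield]).

    Supplementary fields ([supplementary_of_periods]).  Let nu <> p and let L contain
    the periods of a subgroup H of the units modulo nu.  The reduction of the
    integers of L at omega^j is a finite field of some order p^d.  If Delta vanished
    on it, Delta would contain P_d, hence d would divide some k among the k_i, and
    x^(p^k) = x would hold on the reduced periods; summing against the characters
    t -> omega^(-j t) shows that p^k mod nu lies in H, so that nu divides
    p^(k |H|) - 1 and F(p^|H|).  So if nu does not divide F(p^|H|), then for each j
    some integral vector of L has a Delta-value not vanishing at omega^j.  These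
    vectors are merged into one that works for every j ([nonvanishing_everywhere]);
    its value D then satisfies D^(q-1) = 1 modulo p, where q is the order of a finite
    field containing omega, so D lies in no prime ideal over p.

    The choices of nu and mu turn these two criteria into the theorem.  That each
    index d with P_d in Delta divides some k_i uses that only finitely many P_k are
    contained in Delta ([contains_system_bound]), as Delta is primitive. *)

(** * Divisor systems and vanishing over finite fields *)

Lemma intr_pchar_eq0 (R : nzRingType) p (charRp : p \in [pchar R]) (z : int) :
  (z%:~R == 0 :> R) = (p %| z)%Z.
Proof.
by case: z => n; rewrite dvdzE /= ?NegzE ?rmorphN ?oppr_eq0 /= ?(dvdn_pcharf charRp).
Qed.

Lemma poly_int_pchar0 (R : nzRingType) p (charRp : p \in [pchar R])
    (g : {poly int}) :
  map_poly (intr : int -> R) g = 0 -> exists t, g = p%:R * t.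
Proof.
move=> g0; exists (\poly_(i < size g) (g`_i %/ p)%Z).
apply/polyP=> i; rewrite mulr_natl coefMn coef_poly; case: ltnP => [_|/(nth_default 0)->].
  have: (p %| g`_i)%Z.
    by rewrite -(intr_pchar_eq0 charRp) -coef_map_id0 // g0 coef0.
  by move/divzK => {1}<-; rewrite -mulr_natr natz.
by rewrite mul0rn.
Qed.

Lemma mpoly_int_pchar0 (R : nzRingType) p (charRp : p \in [pchar R]) n
    (f : {mpoly int[n]}) :
  map_mpoly (intr : int -> R) f = 0 -> exists c, f = c * p%:R.
Proof.
move=> f0; exists (\sum_(m <- msupp f) (f@_m %/ p)%Z *: 'X_[m]).
rewrite [LHS]mpolyE mulr_suml; apply: eq_bigr => m _.
have: (p %| f@_m)%Z by rewrite -(intr_pchar_eq0 charRp) -mcoeff_map_mpoly f0 mcoeff0.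
move/divzK => {1}<-; rewrite -scalerAl -scalerA mulr_natr -scaler_nat; congr (_ *: _).
by rewrite natz.
Qed.

Lemma rmorph_mevalZ (R S : comNzRingType) (phi : {rmorphism R -> S}) n
    (f : {mpoly int[n]}) (v : 'I_n -> R) :
  phi (map_mpoly intr f).@[v] = (map_mpoly intr f).@[phi \o v].
Proof.
elim/mpolyind: f => [|c m f _ _ IH]; first by rewrite !raddf0.
rewrite !raddfD /= {}IH !map_mpolyZ /= !mevalZ rmorphM rmorph_int.
rewrite !map_mpolyX !mevalX rmorph_prod; congr (_ * _ + _).
by apply: eq_bigr => i _; rewrite rmorphXn.
Qed.

(** Inverting a Vandermonde matrix gives weights w_e on the points with
    sum_j w_e(j) s_j^e' = [e = e'] for e, e' < q; the product weights extract each
    coefficient of f from its values on the grid. *)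
Lemma mpoly_vanish (F : fieldType) n q (s : 'I_q -> F) (f : {mpoly F[n]}) :
    injective s -> (forall m i, (q <= (m : 'X_{1..n}) i)%N -> f@_m = 0) ->
    (forall x : {ffun 'I_n -> 'I_q}, f.@[fun i => s (x i)] = 0) ->
  f = 0.
Proof.
move=> s_inj f_small f_van; apply/mpolyP=> m; rewrite mcoeff0.
have [/existsP[i le_qi]|] := boolP [exists i, (q <= m i)%N]; first exact: f_small le_qi.
rewrite negb_exists => /forallP m_small.
have m_lt i : (m i < q)%N by rewrite ltnNge.
pose V := Vandermonde q (\row_j s j).
have uV : V \in unitmx.
  rewrite unitmxE det_Vandermonde unitfE prodf_seq_neq0.
  apply/allP=> i _; apply/implyP=> _; rewrite prodf_seq_neq0.
  apply/allP=> j _; apply/implyP=> lt_ij; rewrite !mxE subr_eq0.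
  by apply: contraTneq lt_ij => /s_inj->; rewrite ltnn.
pose w i j := invmx V j (Ordinal (m_lt i)).
have wE i e : (e < q)%N -> \sum_j w i j * s j ^+ e = (e == m i)%:R.
  move=> lt_e; have /matrixP/(_ (Ordinal lt_e) (Ordinal (m_lt i))) := mulmxV uV.
  rewrite !mxE => <-; apply: eq_bigr => j _; rewrite !mxE /=.
  by rewrite mulrC.
have: \sum_(x : {ffun 'I_n -> 'I_q}) (\prod_i w i (x i)) * f.@[fun i => s (x i)] = 0.
  by apply: big1 => x _; rewrite f_van mulr0.
under eq_bigr do rewrite mevalE mulr_sumr.
rewrite exchange_big /=.
rewrite (eq_big_seq (fun k => f@_k * (k == m)%:R)) => [|k k_supp].
  have [m_supp|] := boolP (m \in msupp f).
    rewrite (bigD1_seq m) ?msupp_uniq //= eqxx mulr1 big1 ?addr0 // => k /negPf->.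
    by rewrite mulr0.
  by move=> m_supp _; apply: memN_msupp_eq0.
rewrite (eq_bigr (fun x : {ffun 'I_n -> 'I_q} =>
    f@_k * \prod_i (w i (x i) * s (x i) ^+ k i))); last first.
  by move=> x _; rewrite mulrCA -big_split.
rewrite -mulr_sumr -(bigA_distr_bigA (fun i j => w i j * s j ^+ k i)).
congr (_ * _); rewrite (eq_bigr (fun i => (k i == m i)%:R)) => [|i _].
  have [->|ne_km] := eqVneq k m; first by apply: big1 => i _; rewrite eqxx.
  have [/forallP eq_km|] := boolP [forall i, k i == m i].
    by case/eqP: ne_km; apply/mnmP=> i; apply/eqP.
  rewrite negb_forall => /existsP[i /negPf ne_i].
  by rewrite (bigD1 i) //= ne_i mul0r.
apply: wE; rewrite ltnNge; apply: contraL k_supp => /f_small k0.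
by rewrite -mcoeff_eq0 k0.
Qed.

Section DivisorSystem.

Variables (n q : nat).

Definition frobenius_ideal (f : {mpoly int[n]}) : Prop :=
  exists g : 'I_n -> {mpoly int[n]}, f = \sum_(i < n) g i * ('X_i ^+ q - 'X_i).

Lemma frobenius_ideal0 : frobenius_ideal 0.
Proof. by exists (fun=> 0); rewrite big1 // => i _; rewrite mul0r. Qed.

Lemma frobenius_idealD f g :
  frobenius_ideal f -> frobenius_ideal g -> frobenius_ideal (f + g).
Proof.
case=> a -> [b ->]; exists (fun i => a i + b i).
by rewrite -big_split; apply: eq_bigr => i _; rewrite mulrDl.
Qed.

Lemma frobenius_idealMl h f : frobenius_ideal f -> frobenius_ideal (h * f).
Proof.
case=> a ->; exists (fun i => h * a i).
by rewrite mulr_sumr; apply: eq_bigr => i _; rewrite mulrA.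
Qed.

Lemma frobenius_idealX i : frobenius_ideal ('X_i ^+ q - 'X_i).
Proof.
exists (fun j => (j == i)%:R); rewrite (bigD1 i) //= eqxx mul1r big1 ?addr0 //.
by move=> j /negPf->; rewrite mul0r.
Qed.

Lemma frobenius_ideal_vanish (R : comNzRingType) (v : 'I_n -> R) f :
  (forall i, v i ^+ q = v i) -> frobenius_ideal f ->
  (map_mpoly intr f).@[v] = 0.
Proof.
move=> v_fix [g ->]; rewrite -[LHS]/((meval v \o map_mpoly intr) _) rmorph_sum.
apply: big1 => i _; rewrite /= rmorphM rmorphB rmorphXn /= map_mpolyX.
by rewrite mevalM mevalB rmorphXn /= mevalXU v_fix subrr mulr0.
Qed.

Hypothesis q_gt1 : (1 < q)%N.

(** X^e and X^(e - q + 1) are congruent as soon as e >= q. *)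
Lemma reduce_power i e :
  exists2 e', (e' < q)%N & frobenius_ideal ('X_i ^+ e - 'X_i ^+ e').
Proof.
elim/ltn_ind: e => e IHe; have [lt_eq|le_qe] := ltnP e q.
  by exists e => //; rewrite subrr; apply: frobenius_ideal0.
have [|e' lt_e' I_e'] := IHe (e - q).+1.
  by rewrite -subSn // ltn_subLR ?(leqW le_qe) // -[e.+1]add1n ltn_add2r.
exists e' => //; rewrite -(subrKA ('X_i ^+ (e - q).+1)).
apply: frobenius_idealD => //.
rewrite -{1}(subnK le_qe) exprD exprSr -mulrBr.
exact/frobenius_idealMl/frobenius_idealX.
Qed.

Lemma reduce_monomial m :
  exists2 m' : 'X_{1..n}, (forall i, (m' i < q)%N)
    & frobenius_ideal ('X_[m] - 'X_[m']).
Proof.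
have /fin_all_exists2[e lt_e I_e] (i : 'I_n) := reduce_power i (m i).
exists [multinom e i | i < n] => [i|]; first by rewrite mnmE.
rewrite !mpolyXE_id; apply: (big_ind2 (fun a b => frobenius_ideal (a - b))).
- by rewrite subrr; apply: frobenius_ideal0.
- move=> a1 a2 b1 b2 Ia Ib.
  have ->: a1 * b1 - a2 * b2 = b1 * (a1 - a2) + a2 * (b1 - b2).
    by rewrite !mulrBr addrA [b1 * a1]mulrC [b1 * a2]mulrC subrK.
  by apply: frobenius_idealD; apply: frobenius_idealMl.
by move=> i _; rewrite mnmE.
Qed.

Lemma reduce_mpoly f :
  exists2 r, (forall m i, (q <= (m : 'X_{1..n}) i)%N -> r@_m = 0)
    & frobenius_ideal (f - r).
Proof.
elim/mpolyind: f => [|c m f _ _ [r r_small I_r]].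
  exists 0 => [m i _|]; first by rewrite mcoeff0.
  by rewrite subrr; apply: frobenius_ideal0.
have [m' m'_small I_m'] := reduce_monomial m.
exists (c *: 'X_[m'] + r) => [k i le_qk|].
  rewrite mcoeffD mcoeffZ mcoeffX (r_small _ _ le_qk).
  have [Dk|_] := eqVneq m' k; last by rewrite mulr0 addr0.
  by rewrite leqNgt -Dk m'_small in le_qk.
rewrite opprD addrACA -scalerBr -mul_mpolyC.
exact/frobenius_idealD/I_r/frobenius_idealMl.
Qed.

End DivisorSystem.

Lemma contains_system_vanish n (f : {mpoly int[n]}) p k (R : comNzRingType)
    (v : 'I_n -> R) :
    p%:R = 0 :> R -> (forall i, v i ^+ (p ^ k) = v i) ->
  contains_system f p k -> (map_mpoly intr f).@[v] = 0.
Proof.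
move=> p0 v_fix [c [q ->]]; rewrite rmorphD rmorphM /= rmorph_nat mevalD mevalM.
rewrite [meval v _%:R]rmorph_nat p0 mulr0 add0r.
by apply: frobenius_ideal_vanish v_fix _; exists q.
Qed.

(** Replacing f by a reduced polynomial of degree less than p^k in each variable, the
    vanishing on the grid forces all its coefficients to be divisible by p. *)
Lemma vanish_contains_system n (f : {mpoly int[n]}) p k (F : fieldType)
    (s : 'I_(p ^ k) -> F) :
    p \in [pchar F] -> (0 < k)%N -> injective s ->
    (forall j, s j ^+ (p ^ k) = s j) ->
    (forall x : {ffun 'I_n -> 'I_(p ^ k)},
       (map_mpoly intr f).@[fun i => s (x i)] = 0) ->
  contains_system f p k.
Proof.
move=> charFp k_gt0 s_inj s_fix f_van.
have q_gt1 : (1 < p ^ k)%N.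
  by rewrite (ltn_exp2l 0) // prime_gt1 // (pcharf_prime charFp).
have [r r_small I_fr] := reduce_mpoly q_gt1 f.
have r0 : map_mpoly (intr : int -> F) r = 0.
  apply: (mpoly_vanish s_inj) => [m i le_q|x].
    by rewrite mcoeff_map_mpoly (r_small _ _ le_q).
  rewrite -[r](subKr f) rmorphB [LHS]mevalB f_van sub0r.
  by rewrite [meval _ _](frobenius_ideal_vanish _ I_fr) ?oppr0.
have [[c Dr] [g Dg]] := (mpoly_int_pchar0 charFp r0, I_fr).
by exists c, g; rewrite -Dr -Dg addrC subrK.
Qed.

(** For k at least the size of f, the degrees of f in each variable are below p^k, so
    vanishing on the field with p^k elements would make p divide all coefficients. *)
Lemma contains_system_bound n (f : {mpoly int[n]}) p k :
    prime p ->
    (forall d : int, (forall m : 'X_{1..n}, (d %| f@_m)%Z) -> `|d|%N = 1%N) ->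
    (0 < k)%N -> contains_system f p k -> (k < msize f)%N.
Proof.
move=> p_pr f_prim k_gt0 f_k; rewrite ltnNge; apply/negP=> le_fk.
have [F charFp cardF] := pPrimePowerField p_pr k_gt0.
have f0 : map_mpoly (intr : int -> F) f = 0.
  apply: (mpoly_vanish (@enum_val_inj _ F)) => [m i|x].
    rewrite cardF mcoeff_map_mpoly => le_qm; rewrite memN_msupp_eq0 //.
    apply/negP=> /msize_mdeg_lt; rewrite ltnNge (leq_trans le_fk) //.
    rewrite (leq_trans (ltnW (ltn_expl k (prime_gt1 p_pr)))) //.
    by rewrite (leq_trans le_qm) // mdegE (bigD1 i) //= leq_addr.
  apply: contains_system_vanish f_k => [|i]; first exact: pcharf0.
  by rewrite -cardF expf_card.
have p1 : p = 1%N.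
  apply: (f_prim p%:Z) => m.
  by rewrite -(intr_pchar_eq0 charFp) -mcoeff_map_mpoly f0 mcoeff0.
by rewrite p1 in p_pr.
Qed.

(** * Integers of the cyclotomic field of prime order *)

Section IntEval.

Variable R : comNzRingType.

Definition zeval (x : R) : {poly int} -> R := horner_eval x \o map_poly intr.
HB.instance Definition _ x := GRing.RMorphism.on (zeval x).

Lemma zevalE x g : zeval x g = (map_poly intr g).[x].
Proof. by []. Qed.

Lemma zevalXn x n : zeval x 'X^n = x ^+ n.
Proof. by rewrite zevalE map_polyXn hornerXn. Qed.

Lemma zevalX x : zeval x 'X = x. Proof. exact: (zevalXn x 1). Qed.

Lemma zevalC x (a : int) : zeval x a%:P = a%:~R.
Proof. by rewrite zevalE map_polyC hornerC. Qed.

Lemma zeval_comp x g h : zeval x (g \Po h) = zeval (zeval x h) g.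
Proof. by rewrite !zevalE map_comp_poly horner_comp. Qed.

End IntEval.

Lemma rmorph_zeval (R S : comNzRingType) (phi : {rmorphism R -> S}) x g :
  phi (zeval x g) = zeval (phi x) g.
Proof.
rewrite !zevalE -horner_map -map_poly_comp; congr (_.[_]).
by apply: eq_map_poly => a /=; rewrite rmorph_int.
Qed.

(** For n prime this is the n-th cyclotomic polynomial.  The explicit sum can also be
    evaluated at 1 in characteristic n, where it vanishes. *)
Definition geom_poly (n : nat) : {poly int} := \sum_(i < n) 'X^i.

Lemma zeval_geom (R : comNzRingType) (x : R) n :
  zeval x (geom_poly n) = \sum_(i < n) x ^+ i.
Proof. by rewrite rmorph_sum; apply: eq_bigr => i _; rewrite /= zevalXn. Qed.

Lemma geom_polyE n : geom_poly n = \poly_(i < n) 1.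
Proof. by rewrite poly_def; apply: eq_bigr => i _; rewrite scale1r. Qed.

Lemma size_geom n : size (geom_poly n) = n.
Proof.
by case: n => [|n]; rewrite geom_polyE ?size_poly_eq ?oner_eq0 // poly_def big_ord0 size_poly0.
Qed.

Lemma monic_geom n : (0 < n)%N -> geom_poly n \is monic.
Proof.
by case: n => // n _; rewrite monicE lead_coefE size_geom geom_polyE coef_poly leqnn.
Qed.

Lemma geom_rem n (g : {poly int}) : (0 < n)%N ->
  exists s, exists2 r, g = s * geom_poly n + r & (size r < n)%N.
Proof.
move=> /monic_geom geom_mon.
exists (Pdiv.Ring.rdivp g (geom_poly n)), (Pdiv.Ring.rmodp g (geom_poly n)).
  exact: Pdiv.RingMonic.rdivp_eq.
by rewrite -[X in (_ < X)%N]size_geom Pdiv.Ring.ltn_rmodpN0 ?monic_neq0.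
Qed.

Lemma sum_prim_root_expr (R : idomainType) n (x : R) m : n.-primitive_root x ->
  \sum_(k < n) x ^+ (k * m) = (n %| m)%:R * n%:R.
Proof.
move=> prim_x; under eq_bigr do rewrite mulnC exprM.
have [/dvdnP[k ->]|n'm] := boolP (n %| m)%N.
  under eq_bigr do rewrite mulnC exprM (prim_expr_order prim_x) expr1n expr1n.
  by rewrite sumr_const card_ord mul1r.
have x1 : x ^+ m - 1 != 0 by rewrite subr_eq0 -(prim_order_dvd prim_x).
apply: (mulfI x1); rewrite mul0r mulr0 -subrX1 -exprM mulnC exprM.
by rewrite (prim_expr_order prim_x) expr1n subrr.
Qed.

Lemma geom_root (R : idomainType) n (x : R) k : n.-primitive_root x ->
  ~~ (n %| k)%N -> zeval (x ^+ k) (geom_poly n) = 0.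
Proof.
move=> prim_x /negPf n'k; rewrite zeval_geom.
under eq_bigr do rewrite -exprM mulnC.
by rewrite (sum_prim_root_expr _ prim_x) n'k mul0r.
Qed.

Lemma zeval_geom0 (R : idomainType) n (x : R) : prime n ->
  n.-primitive_root x -> zeval x (geom_poly n) = 0.
Proof.
move=> n_pr prim_x; rewrite -[x]expr1 geom_root // dvdn1.
by rewrite neq_ltn prime_gt1 ?orbT.
Qed.

Lemma prime_prim_root (R : idomainType) n (x : R) :
  prime n -> x ^+ n = 1 -> x != 1 -> n.-primitive_root x.
Proof.
move=> n_pr xn1 x1; have [m prim_x] := prim_order_exists (prime_gt0 n_pr) xn1.
case/primeP: n_pr => _ n_pr /n_pr/orP[/eqP m1|/eqP <- //].
by move: prim_x x1; rewrite m1 => /prim_expr_order; rewrite expr1 => ->; rewrite eqxx.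
Qed.

(** Transport to the algebraic numbers, where rational algebraic integers are known to
    be integers. *)
Lemma algint_rat (L : fieldExtType rat) (a : rat) :
  algint (a%:A : L) -> exists z : int, a = z%:~R.
Proof.
case=> g g_mon ga; have ra : root (map_poly (intr : int -> rat) g) a.
  rewrite -(fmorph_root (in_alg L)) -map_poly_comp.
  by rewrite (eq_map_poly (fun z => rmorph_int (in_alg L) z)).
have: (ratr a : algC) \in Num.int.
  apply: Cint_rat_Aint; first by apply/CratP; exists a.
  apply: (@root_monic_Aint (map_poly intr g)).
  - rewrite -(eq_map_poly (fun z => rmorph_int (@ratr algC) z)) map_poly_comp.
    by rewrite fmorph_root.
  - exact: monic_map.
  by apply/polyOverP=> i; rewrite coef_map /= intr_int.
case/intrP=> z Dz; exists z; apply: (fmorph_inj (@ratr algC)).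
by rewrite /= Dz rmorph_int.
Qed.

Section AlgInt.

Variable L : fieldExtType rat.
Implicit Types x y : L.

Lemma algint_zeval x g : algint x -> algint (zeval x g).
Proof.
move=> x_int; apply: integral_horner => //.
by apply/integral_poly=> i; rewrite coef_map; apply: integral_id.
Qed.

Lemma algint_prim_root n x : n.-primitive_root x -> algint x.
Proof.
move=> prim_x; exists ('X^n - 1).
  by rewrite monicXnsubC ?(prim_order_gt0 prim_x).
by rewrite rmorphB rmorph1 /= map_polyXn rootE !hornerE prim_expr_order ?subrr.
Qed.

Lemma algint_sum (I : finType) (f : I -> L) :
  (forall i, algint (f i)) -> algint (\sum_i f i).
Proof.
move=> f_int; apply: (big_ind (@algint L)) => //; first exact: integral0.
exact: integral_add.
Qed.

Lemma algintX x n : algint x -> algint (x ^+ n).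
Proof.
move=> x_int; elim: n => [|n IH]; first exact: integral1.
by rewrite exprS; apply: integral_mul.
Qed.

End AlgInt.

Lemma algint_fmorph (L M : fieldExtType rat) (f : {rmorphism L -> M}) x :
  algint (f x) <-> algint x.
Proof.
have E g : map_poly intr g = map_poly f (map_poly intr g) :> {poly M}.
  by rewrite -map_poly_comp; apply: eq_map_poly => z /=; rewrite rmorph_int.
by split=> -[g g_mon gx]; exists g => //; move: gx; rewrite E fmorph_root.
Qed.

Section PrimeCyclotomic.

Variables (nu : nat) (Gamma : fieldExtType rat) (zeta : Gamma).
Hypotheses (nu_pr : prime nu) (zetaP : nu.-primitive_root zeta).

Local Notation qpoly g := (map_poly (in_alg Gamma) g).

Lemma qpoly_int (g : {poly int}) : qpoly (map_poly intr g) = map_poly intr g.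
Proof.
by rewrite -map_poly_comp; apply: eq_map_poly => z; apply: (rmorph_int (in_alg Gamma)).
Qed.

(** The gcd of g and the cyclotomic polynomial is not constant, hence has a complex root,
    which is a primitive nu-th root of unity; its minimal polynomial over Q is the
    cyclotomic polynomial, which therefore divides the gcd. *)
Lemma geom_rat_dvd (g : {poly rat}) : root (qpoly g) zeta ->
  map_poly intr (geom_poly nu) %| g.
Proof.
set phi := map_poly intr _ => g_zeta; pose d := gcdp g phi.
have phi_zeta : root (qpoly phi) zeta.
  by apply/rootP; rewrite qpoly_int -zevalE zeval_geom0.
have d_zeta : root (qpoly d) zeta by rewrite gcdp_map root_gcd g_zeta.
have phi_neq0 : phi != 0 by rewrite map_poly_eq0_id0 ?monic_neq0 ?monic_geom ?prime_gt0 //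
  (monicP (monic_geom (prime_gt0 nu_pr))) ?oner_eq0.
have d_neq0 : d != 0 by rewrite gcdp_eq0 negb_and phi_neq0 orbT.
have /closed_rootP[z dz] : size (map_poly (@ratr algC) d) != 1%N.
  rewrite size_map_poly -(size_map_poly (in_alg Gamma)) neq_ltn.
  by rewrite (root_size_gt1 _ d_zeta) ?map_poly_eq0 ?orbT.
have phiC : map_poly (@ratr algC) phi = map_poly intr (geom_poly nu).
  by rewrite -map_poly_comp; apply: eq_map_poly => a /=; rewrite rmorph_int.
have phi_z : \sum_(i < nu) z ^+ i = 0.
  rewrite -zeval_geom zevalE -phiC; apply/rootP.
  by apply: root_dvdp dz; rewrite dvdp_map dvdp_gcdr.
have prim_z : nu.-primitive_root z.
  apply: prime_prim_root => //.
    by apply/eqP; rewrite -subr_eq0 subrX1 phi_z mulr0.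
  apply: contra_eq_neq phi_z => ->; under eq_bigr do rewrite expr1n.
  by rewrite sumr_const card_ord pnatr_eq0 -lt0n prime_gt0.
have [m [Dm m_mon] m_dvd] := minCpolyP z; rewrite m_dvd in dz.
have sz_m : size m = nu.
  rewrite -(size_map_poly (@ratr algC)) -Dm (minCpoly_cyclotomic prim_z).
  by rewrite size_cyclotomic totient_prime // prednK ?prime_gt0.
have sz_phi : size phi = nu.
  by rewrite size_map_inj_poly ?size_geom //; apply: intr_inj.
have m_phi : m %| phi by apply: dvdp_trans dz _; rewrite dvdp_gcdr.
have: m %= phi by rewrite -dvdp_size_eqp // sz_m sz_phi.
by move/eqp_dvdl <-; apply: dvdp_trans dz _; rewrite dvdp_gcdl.
Qed.

Lemma rat_conj_root (g : {poly rat}) k : ~~ (nu %| k)%N ->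
  root (qpoly g) zeta -> root (qpoly g) (zeta ^+ k).
Proof.
move=> nu'k /geom_rat_dvd; rewrite -(dvdp_map (in_alg Gamma)) => /root_dvdp; apply.
by apply/rootP; rewrite qpoly_int -zevalE geom_root.
Qed.

Lemma zeval_small (g : {poly int}) :
  zeval zeta g = 0 -> (size g < nu)%N -> g = 0.
Proof.
rewrite zevalE -qpoly_int => /rootP/geom_rat_dvd g_dvd sz_g.
apply: (map_inj_poly (intr_inj : injective (intr : int -> rat))) => //.
rewrite rmorph0; apply: contraTeq g_dvd => g_neq0; apply/negP=> /(dvdp_leq g_neq0).
rewrite !size_map_inj_poly //; try exact: intr_inj.
by rewrite size_geom leqNgt sz_g.
Qed.

Lemma zeval_eq0 (g : {poly int}) :
  zeval zeta g = 0 -> exists s, g = s * geom_poly nu.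
Proof.
have [s [r -> sz_r]] := geom_rem g (prime_gt0 nu_pr).
rewrite rmorphD rmorphM /= (zeval_geom0 nu_pr zetaP) mulr0 add0r => /zeval_small-> //.
by exists s; rewrite addr0.
Qed.

(** This makes the reduction g(zeta) -> g(omega) of Z[zeta] well defined. *)
Lemma zeval_reduction (R : comNzRingType) (omega : R) (g h : {poly int}) :
    zeval omega (geom_poly nu) = 0 ->
  zeval zeta g = zeval zeta h -> zeval omega g = zeval omega h.
Proof.
move=> geom0 eq_gh; have [|s Ds] := @zeval_eq0 (g - h).
  by rewrite rmorphB /= eq_gh subrr.
by rewrite -[g](subrK h) Ds rmorphD rmorphM /= geom0 mulr0 add0r.
Qed.

(** If h(g(zeta)) = 0, then the polynomial h o g vanishes at all conjugates of zeta. *)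
Lemma algint_conj (g : {poly rat}) k : ~~ (nu %| k)%N ->
  algint (qpoly g).[zeta] -> algint (qpoly g).[zeta ^+ k].
Proof.
move=> nu'k [h h_mon h_g]; exists h => //.
have E x : (map_poly intr h).[(qpoly g).[x]] = (qpoly (map_poly intr h \Po g)).[x].
  by rewrite map_comp_poly horner_comp qpoly_int.
by apply/rootP; rewrite E; apply/rootP/rat_conj_root; rewrite // rootE -E.
Qed.

(** Orthogonality of the nu-th roots of unity.  Summing over all powers, including the
    power 0, keeps the formula uniform; differences of two such sums are traces. *)
Lemma trace_coef (g : {poly rat}) j m : (size g <= nu)%N -> (j < nu)%N ->
  (j + m = nu)%N ->
  \sum_(k < nu) (qpoly g).[zeta ^+ k] * zeta ^+ (k * m) = (nu%:R * g`_j)%:A.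
Proof.
move=> sz_g lt_j Dm.
have sz_qg : (size (qpoly g) <= nu)%N by rewrite size_map_poly.
under eq_bigr do rewrite (horner_coef_wide _ sz_qg) mulr_suml.
rewrite exchange_big /= (bigD1 (Ordinal lt_j)) //= addrC big1 => [|i ne_ij].
  rewrite add0r; under eq_bigr do rewrite -mulrA -exprM -exprD -mulnDr.
  rewrite -mulr_sumr (sum_prim_root_expr _ zetaP) Dm dvdnn mul1r coef_map /=.
  by rewrite mulrC -scaler_nat -scalerA mulr_algl scaler_nat -scaler_nat.
under eq_bigr do rewrite -mulrA -exprM -exprD -mulnDr.
rewrite -mulr_sumr (sum_prim_root_expr _ zetaP).
suffices /negPf-> : ~~ (nu %| i + m)%N by rewrite mul0r mulr0.
have lt_i := ltn_ord i; have [lt_ij|le_ji] := ltnP i j.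
  by rewrite gtnNdvd; lia.
have ne_ij' : (i : nat) != j by [].
have -> : (i + m = (i - j) + nu)%N by lia.
by rewrite dvdn_addl // gtnNdvd; lia.
Qed.

(** Each coefficient times nu is the trace of an algebraic integer: in the difference of
    the two sums given by [trace_coef] for the coefficients of index j and nu - 1, the
    second being 0, the term at k = 0 cancels. *)
Lemma nu_mul_zeval x : <<1; zeta>>%VS = fullv -> algint x ->
  exists h, nu%:R * x = zeval zeta h.
Proof.
move=> gen_zeta x_int.
have [g0 Dg0] : exists g, x = (qpoly g).[zeta].
  by apply/Fadjoin1_polyP; rewrite gen_zeta memvf.
pose phi : {poly rat} := map_poly intr (geom_poly nu).
have sz_phi : size phi = nu.
  by rewrite size_map_inj_poly ?size_geom //; apply: intr_inj.
have phi_neq0 : phi != 0 by rewrite -size_poly_gt0 sz_phi prime_gt0.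
have [g Dg sz_g] : exists2 g, x = (qpoly g).[zeta] & (size g < nu)%N.
  exists (g0 %% phi); last by rewrite -[X in (_ < X)%N]sz_phi ltn_modpN0.
  rewrite Dg0 {1}(divp_eq g0 phi) rmorphD rmorphM /= hornerD hornerM.
  by rewrite [qpoly phi]qpoly_int -zevalE (zeval_geom0 nu_pr zetaP) mulr0 add0r.
have coef_int (j : 'I_nu) : exists z : int, nu%:R * g`_j = z%:~R.
  apply: (@algint_rat Gamma).
  have lt_nu1 : (nu.-1 < nu)%N by rewrite prednK ?prime_gt0.
  have g_last : g`_nu.-1 = 0.
    by rewrite nth_default // -ltnS prednK ?prime_gt0.
  have -> : (nu%:R * g`_j)%:A = (nu%:R * g`_j)%:A - (nu%:R * g`_nu.-1)%:A :> Gamma.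
    by rewrite g_last mulr0 scale0r subr0.
  rewrite -(trace_coef (ltnW sz_g) _ (subnKC (ltnW (ltn_ord j)))) //.
  rewrite -(@trace_coef g _ 1%N (ltnW sz_g)) ?addn1 ?prednK ?prime_gt0 //.
  rewrite -sumrB; apply: algint_sum => k; rewrite -mulrBr muln1.
  have [k0|k_gt0] := posnP k; first by rewrite k0 mul0n subrr mulr0; apply: integral0.
  have zeta_int := algint_prim_root zetaP.
  apply: integral_mul; last by apply: integral_sub; apply: algintX.
  by apply: algint_conj; rewrite -?Dg // gtnNdvd.
have /fin_all_exists[z Dz] := coef_int.
exists (\poly_(i < nu) oapp z 0 (insub i)).
suffices D : map_poly intr (\poly_(i < nu) oapp z 0 (insub i)) = nu%:R *: g.
  by rewrite zevalE -qpoly_int D Dg map_polyZ hornerZ /= scaler_nat mulr_natl.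
apply/polyP=> i; rewrite coef_map_id0 // coef_poly coefZ.
case: ltnP => [lt_i|le_i]; first by case: insubP => [u _ <-|/negP[]//]; rewrite /= -Dz.
by rewrite nth_default ?mulr0 // (leq_trans (ltnW sz_g)).
Qed.

Lemma frobenius_XsubC1 : exists s : {poly int},
  ('X - 1) ^+ nu = 'X^nu - 1 + nu%:R * s.
Proof.
have charFnu := pchar_Fp nu_pr.
have charP : nu \in [pchar {poly 'F_nu}] by rewrite pchar_poly.
have [|s Ds] := @poly_int_pchar0 _ _ charFnu (('X - 1) ^+ nu - ('X^nu - 1)).
  rewrite !rmorphB rmorphXn rmorphB /= !rmorph1 map_polyXn map_polyX.
  by rewrite -pFrobenius_autE pFrobenius_autB_comm ?pFrobenius_autE
     ?expr1n ?subrr //; apply: commr1.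
by exists s; rewrite -Ds [RHS]addrC subrK.
Qed.

(** Write pi = zeta - 1 and g = g(1) + (X - 1) h.  Then g(1) is pi times an algebraic
    integer, and pi^nu is divisible by nu, so nu divides the integer g(1)^nu, hence
    g(1); as pi divides nu in Z[zeta], pi divides g(zeta) there. *)
Lemma zeval_div_pi x : algint x ->
  (exists g, (zeta - 1) * x = zeval zeta g) -> exists h, x = zeval zeta h.
Proof.
move=> x_int [g Dg]; have zeta_int := algint_prim_root zetaP.
have zeta1 : zeta - 1 != 0.
  by rewrite subr_eq0 -[zeta]expr1 -(prim_order_dvd zetaP) dvdn1 neq_ltn prime_gt1 ?orbT.
have [h Dh] : exists h, g - g.[1]%:P = h * ('X - 1%:P).
  by apply/factor_theorem; rewrite rootE !hornerE subrr.
(* pi divides nu in Z[zeta], because the cyclotomic polynomial takes the value nu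
   at 1. *)
have [psi Dpsi] : exists psi, geom_poly nu - nu%:R = psi * ('X - 1%:P).
  apply/factor_theorem; rewrite rootE hornerD hornerN -polyC_natr hornerC.
  by rewrite horner_sum; under eq_bigr do rewrite hornerXn expr1n;
     rewrite sumr_const card_ord subrr.
have [s Ds] := frobenius_XsubC1.
have zX1 : zeval zeta ('X - 1) = zeta - 1 by rewrite rmorphB rmorph1 /= zevalX.
have pi_nu : (zeta - 1) ^+ nu = nu%:R * zeval zeta s.
  rewrite -zX1 -rmorphXn Ds /= rmorphD rmorphB rmorphM rmorph1 rmorph_nat /= zevalXn.
  by rewrite (prim_expr_order zetaP) subrr add0r.
have nu_pi : nu%:R = (1 - zeta) * zeval zeta psi.
  have:= congr1 (zeval zeta) Dpsi; rewrite !rmorphB /= (zeval_geom0 nu_pr zetaP) rmorph_nat sub0r.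
  by rewrite rmorphM /= zX1 => E; rewrite -[LHS]opprK E mulrC -mulNr opprB.
set a := g.[1]; pose b := x - zeval zeta h.
have Da : a%:~R = (zeta - 1) * b.
  rewrite mulrBr Dg -(zevalC zeta) -/a mulrC -zX1 -rmorphM /= -Dh rmorphB /=.
  by rewrite opprB addrC subrK.
have b_int : algint b by apply: integral_sub => //; apply: algint_zeval.
have [z Dz] : exists z : int, (a%:~R ^+ nu / nu%:R : rat) = z%:~R.
  apply: (@algint_rat Gamma); have nu0 : nu%:R != 0 :> rat by rewrite pnatr_eq0 -lt0n prime_gt0.
  have -> : (a%:~R ^+ nu / nu%:R)%:A = zeval zeta s * b ^+ nu.
    have nu0' : nu%:R != 0 :> Gamma.
      by rewrite -(rmorph_nat (in_alg Gamma)) fmorph_eq0.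
    apply: (mulfI nu0'); rewrite mulrA -pi_nu -exprMn -Da -(rmorph_nat (in_alg Gamma)).
    by rewrite -[LHS]rmorphM mulrC divfK // -(rmorph_int (in_alg Gamma)) -[RHS]rmorphXn.
  by apply: integral_mul; [apply: algint_zeval | apply: algintX].
have : (nu %| a ^+ nu)%Z.
  apply/dvdzP; exists z; apply: (@intr_inj rat); rewrite intrM -Dz rmorphXn /=.
  by rewrite divfK // pnatr_eq0 -lt0n prime_gt0.
rewrite dvdzE abszX absz_nat Euclid_dvdX // prime_gt0 // andbT => nu_a.
have /dvdzP[t Dt] : (nu %| a)%Z by [].
exists (h - t%:P * psi); apply: (mulfI zeta1).
rewrite rmorphB rmorphM /= zevalC mulrBr.
have -> : (zeta - 1) * (t%:~R * zeval zeta psi) = - a%:~R.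
  by rewrite Dt intrM -[nu%:~R]/(nu%:R) nu_pi mulrCA -mulrN -mulNr opprB.
by rewrite opprK Da -mulrDr /b [zeval _ _ + _]addrC subrK.
Qed.

(** nu x lies in Z[zeta] and pi^nu is a multiple of nu, so pi^nu x lies in Z[zeta]; the
    factors pi are then divided out one at a time. *)
Theorem algint_cyclotomic x : <<1; zeta>>%VS = fullv -> algint x ->
  exists g, x = zeval zeta g.
Proof.
move=> gen_zeta x_int; have [h Dh] := nu_mul_zeval gen_zeta x_int.
have [s Ds] := frobenius_XsubC1.
have zX1 : zeval zeta ('X - 1) = zeta - 1 by rewrite rmorphB rmorph1 /= zevalX.
have: exists g, (zeta - 1) ^+ nu * x = zeval zeta g.
  exists (s * h); rewrite rmorphM /= -Dh mulrA [_ * nu%:R]mulrC; congr (_ * _).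
  rewrite -zX1 -rmorphXn Ds /= rmorphD rmorphB rmorphM rmorph1 rmorph_nat /= zevalXn.
  by rewrite (prim_expr_order zetaP) subrr add0r.
elim: {h s Dh Ds}nu => [|m IHm]; first by rewrite mul1r.
rewrite exprS -mulrA => /zeval_div_pi[|g Dg]; last by apply: IHm; exists g.
apply: integral_mul x_int; apply: algintX.
by apply: integral_sub; [apply: algint_prim_root zetaP | apply: integral1].
Qed.

End PrimeCyclotomic.

(** * The two criteria *)

Lemma zeval_frobenius (R : comNzRingType) p (charRp : p \in [pchar R]) k
    (x : R) (g : {poly int}) :
  zeval x g ^+ (p ^ k) = zeval (x ^+ (p ^ k)) g.
Proof.
elim: k => [|k IHk]; first by rewrite !expr1.
by rewrite expnSr !exprM IHk -!(pFrobenius_autE charRp) rmorph_zeval.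
Qed.

(** By Fermat, nu divides p^(nu-1) - 1, the order of the group of units of the field
    with p^(nu-1) elements; Cauchy's theorem gives an element of order nu. *)
Lemma finite_field_prim_root p nu : prime p -> prime nu -> nu <> p ->
  exists (F : finFieldType) (omega : F), p \in [pchar F] /\ nu.-primitive_root omega.
Proof.
move=> p_pr nu_pr ne_nu_p; have nu_gt1 := prime_gt1 nu_pr.
have nu1_gt0 : (0 < nu.-1)%N by rewrite -subn1 subn_gt0.
have [F charFp cardF] := pPrimePowerField p_pr nu1_gt0.
have nu_dvd : (nu %| #|[set: {unit F}]|)%N.
  rewrite card_finField_unit cardF -subn1 -eqn_mod_dvd ?expn_gt0 ?prime_gt0 //.
  rewrite -(totient_prime nu_pr) Euler_exp_totient // coprime_sym prime_coprime //.
  by rewrite dvdn_prime2 //; apply/eqP.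
have [u _ ord_u] := Cauchy nu_pr nu_dvd; exists F, (val u); split=> //.
apply: prime_prim_root => //.
  by rewrite -[nu]ord_u -FinRing.val_unitX expg_order.
apply: contraTneq nu_gt1 => u1; have u_1 : u = 1%g by apply: val_inj.
by rewrite -ord_u u_1 order1.
Qed.

(** S is a subgroup of a p-group, and multiplication by a nonzero x permutes the nonzero
    elements of S. *)
Lemma finite_subfield (F : finFieldType) p (S : {set F}) : p \in [pchar F] ->
    1 \in S -> {in S &, forall x y, x - y \in S} -> {in S &, forall x y, x * y \in S} ->
  exists2 d, (0 < d)%N /\ #|S| = (p ^ d)%N & {in S, forall x, x ^+ (p ^ d) = x}.
Proof.
move=> charFp S1 SB SM.
have S0 : 0 \in S by rewrite -(subrr 1) SB.
have SD : {in S &, forall x y, x + y \in S}.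
  by move=> x y Sx Sy; rewrite -[y]opprK SB // -sub0r SB.
have gS : group_set S by apply/group_setP; split.
have pS : (p.-group S)%g.
  exact: pgroupS (subsetT (Group gS)) (pprimeChar_pgroup charFp).
have [d cardS] := p_natP pS.
have cardS_gt1 : (1 < #|S|)%N.
  by apply/card_gt1P; exists 0, 1; rewrite // eq_sym oner_eq0.
exists d; first by split=> //; case: d cardS cardS_gt1 => // ->.
move=> x Sx; rewrite -cardS; have [->|x0] := eqVneq x 0.
  by rewrite expr0n gtn_eqF // ltnW.
pose P := \prod_(y in S :\ 0) y.
have P0 : P != 0 by apply/prodf_neq0=> y /setD1P[].
have xS : [set x * y | y in S :\ 0] = S :\ 0.
  apply/eqP; rewrite eqEcard card_imset ?leqnn ?andbT; last exact: mulfI.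
  apply/subsetP=> _ /imsetP[y /setD1P[y0 Sy] ->].
  by rewrite !inE mulf_neq0 ?SM.
have: P = x ^+ #|S :\ 0| * P.
  rewrite -prodr_const -big_split /= {1}/P -[in LHS]xS big_imset //.
  by move=> y z _ _; apply: mulfI.
rewrite -[X in X = _]mul1r => /(mulIf P0) x1.
by rewrite (cardsD1 0) S0 addnC exprD -x1 mul1r expr1.
Qed.

Lemma dvdn_sub1_Fp nu m : prime nu -> (0 < m)%N ->
  (nu %| m - 1)%N = (m%:R == 1 :> 'F_nu).
Proof.
by move=> nu_pr m_gt0; rewrite (dvdn_pcharf (pchar_Fp nu_pr)) natrB // subr_eq0.
Qed.

Lemma Fval_dvd nu ks x : prime nu ->
  (nu %| Fval ks x)%N = has (fun k => nu %| x ^ k - 1)%N ks.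
Proof.
move=> nu_pr; rewrite /Fval; elim: ks => [|k ks IH].
  by rewrite big_nil Euclid_dvd1.
by rewrite big_cons Euclid_dvdM // IH.
Qed.

(** Going from an index to a proper multiple that is again contained in Delta stops,
    since the indices are bounded. *)
Lemma contains_system_maximal n (Delta : {mpoly int[n]}) p ks d : prime p ->
    (forall a : int, (forall m : 'X_{1..n}, (a %| Delta@_m)%Z) -> `|a|%N = 1%N) ->
    maximal_systems Delta p ks -> (0 < d)%N -> contains_system Delta p d ->
  exists2 k, k \in ks & (d %| k)%N.
Proof.
move=> p_pr prim_Delta [_ ksP].
have [b le_b] := ubnP (msize Delta - d); elim: b => // b IHb in d le_b *.
move=> d_gt0 Delta_d.
have [|no_k] := classic (exists k,
    [/\ (0 < k)%N, contains_system Delta p k, (d %| k)%N & k <> d]); last first.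
  exists d => //; apply/ksP; split=> // k k_gt0 Delta_k dv_dk.
  by apply: NNPP => ne_kd; case: no_k; exists k.
move=> [k [k_gt0 Delta_k dv_dk ne_kd]].
have lt_k := contains_system_bound p_pr prim_Delta k_gt0 Delta_k.
have le_dk := dvdn_leq k_gt0 dv_dk.
have [|k' ks_k' dv_kk'] := IHb k _ k_gt0 Delta_k; first by lia.
by exists k' => //; apply: dvdn_trans dv_kk'.
Qed.

(** The remainder of h modulo the cyclotomic polynomial has degree less than nu - 1, and
    nu - 1 distinct roots modulo p. *)
Lemma zeval_all_conj (F : idomainType) p nu (omega : F) (h : {poly int}) :
    p \in [pchar F] -> nu.-primitive_root omega ->
    (forall j, (0 < j < nu)%N -> zeval (omega ^+ j) h = 0) ->
  exists s t, h = s * geom_poly nu + p%:R * t.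
Proof.
move=> charFp omegaP h_root; have nu_gt0 := prim_order_gt0 omegaP.
have [s [r Dh sz_r]] := geom_rem h nu_gt0.
have [|t Dr] := @poly_int_pchar0 _ _ charFp r; last by exists s, t; rewrite -Dr.
apply: (@roots_geq_poly_eq0 _ _ [seq omega ^+ j | j <- iota 1 nu.-1]).
- apply/allP=> _ /mapP[j j_lt ->]; apply/rootP.
  move: j_lt; rewrite mem_iota add1n prednK // => j_lt.
  have:= h_root j j_lt; rewrite Dh rmorphD rmorphM /= (geom_root omegaP) ?mulr0 ?add0r //.
  by case/andP: j_lt => j_gt0 j_lt; rewrite gtnNdvd.
- rewrite map_inj_in_uniq ?iota_uniq // => i j.
  rewrite !mem_iota add1n prednK // => /andP[_ lt_i] /andP[_ lt_j] /eqP.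
  by rewrite (eq_prim_root_expr omegaP) !modn_small // => /eqP.
by rewrite size_map size_iota (leq_trans (size_poly _ _)) // -ltnS prednK.
Qed.

Section Supplementary.

Variables (nu : nat) (Gamma : fieldExtType rat) (zeta : Gamma).
Hypotheses (nu_pr : prime nu) (zetaP : nu.-primitive_root zeta).
Hypothesis (gen_zeta : <<1; zeta>>%VS = fullv).
Variables (L : fieldExtType rat) (iota : {rmorphism L -> Gamma}).
Variables (n p : nat) (Delta : {mpoly int[n]}).

Lemma zeval_mpoly (R : comNzRingType) (x : R) (g : 'I_n -> {poly int}) :
  zeval x (map_mpoly intr Delta).@[g] = (map_mpoly intr Delta).@[zeval x \o g].
Proof. exact: rmorph_mevalZ. Qed.

(** The prime ideal is the kernel of the reduction g(zeta) -> g(omega) on the integers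
    of L. *)
Lemma not_supplementary (F : fieldType) (omega : F) k :
    p \in [pchar F] -> zeval omega (geom_poly nu) = 0 ->
    contains_system Delta p k ->
    (forall x g, iota x = zeval zeta g -> zeval omega g ^+ (p ^ k) = zeval omega g) ->
  ~ supplementary Delta p L.
Proof.
move=> charFp geom0 Delta_k fixk [a a_int].
have algintP x : algint x -> exists g, iota x = zeval zeta g.
  by move=> x_int; apply: (algint_cyclotomic nu_pr zetaP gen_zeta); apply/algint_fmorph.
have red := zeval_reduction nu_pr zetaP geom0.
pose P x := exists2 g, iota x = zeval zeta g & zeval omega g = 0.
have prime_P : prime_ideal P.
  split.
  - move=> x [g Dg _]; apply/(algint_fmorph iota); rewrite Dg.
    exact/algint_zeval/algint_prim_root/zetaP.
  - split; first by exists 0; rewrite !rmorph0.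
    move=> x y [g Dg g0] [h Dh h0]; exists (g + h); first by rewrite !rmorphD /= Dg Dh.
    by rewrite rmorphD /= g0 h0 addr0.
  - move=> x y /algintP[g Dg] [h Dh h0]; exists (g * h); rewrite !rmorphM /= ?Dg ?Dh //.
    by rewrite h0 mulr0.
  - case=> g Dg; have /red <- : zeval zeta 1 = zeval zeta g by rewrite -Dg !rmorph1.
    by rewrite rmorph1; apply/eqP/oner_neq0.
  move=> x y /algintP[g Dg] /algintP[h Dh] [f Df f0].
  have: zeval omega (g * h) = 0.
    by rewrite -f0; apply: red; rewrite rmorphM /= -Dg -Dh -rmorphM.
  rewrite rmorphM /= => /eqP; rewrite mulf_eq0 => /orP[]/eqP gh0; [left | right].
    by exists g.
  by exists h.
move/(_ P prime_P); apply.
  by exists p%:R; rewrite !rmorph_nat // (pcharf0 charFp).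
have /fin_all_exists[g Dg] (i : 'I_n) := algintP _ (a_int i).
exists (map_mpoly intr Delta).@[g].
  by rewrite zeval_mpoly rmorph_mevalZ; apply: meval_eq => i /=.
rewrite zeval_mpoly; apply: contains_system_vanish Delta_k; first exact: pcharf0.
by move=> i; apply: fixk (Dg i).
Qed.

Section Construction.

Variables (F : finFieldType) (omega : F).
Hypotheses (charFp : p \in [pchar F]) (omegaP : nu.-primitive_root omega).
Hypothesis ne_nu_p : nu <> p.
Variable H : {group {unit 'F_nu}}.
Hypothesis periods : forall t : nat,
  exists x, iota x = \sum_(u in H) zeta ^+ (val u * t).

(** The polynomials that represent integers of L. *)
Let rep (g : {poly int}) := exists x, iota x = zeval zeta g.

Let repD g h : rep g -> rep h -> rep (g + h).
Proof. by case=> x Dx [y Dy]; exists (x + y); rewrite !rmorphD /= Dx Dy. Qed.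

Let repN g : rep g -> rep (- g).
Proof. by case=> x Dx; exists (- x); rewrite !rmorphN /= Dx. Qed.

Let repM g h : rep g -> rep h -> rep (g * h).
Proof. by case=> x Dx [y Dy]; exists (x * y); rewrite !rmorphM /= Dx Dy. Qed.

Let rep1 : rep 1. Proof. by exists 1; rewrite !rmorph1. Qed.

Let rep_mpoly g : (forall i, rep (g i)) -> rep (map_mpoly intr Delta).@[g].
Proof.
move=> /fin_all_exists[x Dx]; exists (map_mpoly intr Delta).@[x].
by rewrite zeval_mpoly rmorph_mevalZ; apply: meval_eq => i /=.
Qed.

(** With r = p^k, the hypothesis applied to the periods says that t -> sum over u in H of
    omega^(j t r u) does not change when r is replaced by 1.  Multiplying by omega^(-j t)
    and summing over t counts the u in H with r u = 1 modulo nu, times the invertible nu.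
    The count is 1 for r = 1, so r is inverse to an element of H. *)
Lemma frobenius_mem_periods j k : ~~ (nu %| j)%N ->
    (forall g, rep g -> zeval (omega ^+ j) g ^+ (p ^ k) = zeval (omega ^+ j) g) ->
  (nu %| p ^ (k * #|H|) - 1)%N.
Proof.
move=> nu'j fixk; have nu_gt0 := prime_gt0 nu_pr.
have nuF0 : nu%:R != 0 :> F.
  rewrite -(dvdn_pcharf charFp) dvdn_prime2 ?(pcharf_prime charFp) //.
  by apply/eqP=> /esym.
pose r := (p ^ k)%N.
have sum_eq (t : nat) :
  \sum_(u in H) omega ^+ (t * (j * (r * val u))) = \sum_(u in H) omega ^+ (t * (j * val u)).
  have [x Dx] := periods t.
  pose g : {poly int} := \sum_(u in H) 'X^(val u * t).
  have gE (R : comNzRingType) (y : R) : zeval y g = \sum_(u in H) y ^+ (val u * t).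
    by rewrite rmorph_sum; apply: eq_bigr => u _; rewrite /= zevalXn.
  have := fixk g; rewrite zeval_frobenius // !gE => fix_g.
  transitivity (\sum_(u in H) omega ^+ j ^+ r ^+ (val u * t)).
    by apply: eq_bigr => u _; rewrite -!exprM; congr (_ ^+ _); lia.
  rewrite fix_g; last by exists x; rewrite gE.
  by apply: eq_bigr => u _; rewrite -!exprM; congr (_ ^+ _); lia.
(* The exponent nu - 1 stands for -1. *)
have count_eq s : \sum_(t < nu) omega ^+ (t * (j * nu.-1)) * \sum_(u in H) omega ^+ (t * (j * (s * val u)))
  = #|[set u in H | (nu %| s * val u + nu.-1)%N]|%:R * nu%:R :> F.
  under eq_bigr do rewrite mulr_sumr.
  rewrite exchange_big /=.
  under eq_bigr => u _.
    under eq_bigr do rewrite -exprD -mulnDr -mulnDr addnC.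
    rewrite sum_prim_root_expr // Euclid_dvdM // (negPf nu'j) /=.
    over.
  rewrite -mulr_suml -natr_sum -sum1_card big_mkcond /=; congr (_%:R * _).
  by rewrite [RHS]big_mkcond; apply: eq_bigr => u _; rewrite inE; case: (u \in H).
have charFnu := pchar_Fp nu_pr.
have dvd_mod s (u : {unit 'F_nu}) :
    (nu %| s * val u + nu.-1)%N = (s%:R * val u == 1 :> 'F_nu).
  rewrite (dvdn_pcharf charFnu) natrD natrM natr_Zp -subn1 natrB //.
  by rewrite pchar_Fp_0 // sub0r subr_eq0.
have [v Hv rv1] : exists2 v, v \in H & r%:R * val v = 1.
  apply: NNPP => no_v.
  have: #|[set u in H | (nu %| r * val u + nu.-1)%N]|%:R * nu%:R
      = #|[set u in H | (nu %| 1 * val u + nu.-1)%N]|%:R * nu%:R :> F.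
    rewrite -!count_eq; apply: eq_bigr => t _; rewrite sum_eq; congr (_ * _).
    by apply: eq_bigr => u _; rewrite mul1n.
  have -> : [set u in H | (nu %| r * val u + nu.-1)%N] = set0.
    apply/setP=> u; rewrite !inE dvd_mod; apply/negP=> /andP[Hu /eqP ru1].
    by case: no_v; exists u.
  have -> : [set u in H | (nu %| 1 * val u + nu.-1)%N] = [set 1%g].
    apply/setP=> u; rewrite !inE dvd_mod mul1r; apply/andP/eqP => [[_ /eqP u1]|->].
      exact: val_inj.
    by rewrite group1 /= eqxx.
  by rewrite cards0 cards1 mul0r mul1r => /esym/eqP/negPn; rewrite nuF0.
rewrite expnM -/r dvdn_sub1_Fp ?expn_gt0 ?prime_gt0 ?(pcharf_prime charFp) // natrX.
have := congr1 (fun y => y ^+ #|H|) rv1; rewrite exprMn expr1n.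
by rewrite -FinRing.val_unitX expg_cardG //= mulr1 => ->.
Qed.

(** The reductions at omega^j of the integers of L form a finite field, with p^d elements
    say; were Delta to vanish on it, it would contain P_d. *)
Lemma nonvanishing_at j : ~~ (nu %| j)%N ->
    (forall d, (0 < d)%N -> contains_system Delta p d ->
       exists2 k, (d %| k)%N & ~~ (nu %| p ^ (k * #|H|) - 1)%N) ->
  exists2 g, (forall i : 'I_n, rep (g i))
    & (map_mpoly intr Delta).@[zeval (omega ^+ j) \o g] != 0.
Proof.
move=> nu'j not_Delta; apply: NNPP => no_g.
have van g : (forall i : 'I_n, rep (g i)) ->
    (map_mpoly intr Delta).@[zeval (omega ^+ j) \o g] = 0.
  by move=> rep_g; apply/eqP; apply: contra_notT no_g; exists g.
pose inS y := exists2 g, rep g & zeval (omega ^+ j) g = y.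
(* The image need not be decidable a priori; excluded middle turns it into a
   finite set. *)
pose S := [set y | if excluded_middle_informative (inS y) then true else false].
have SP y : reflect (inS y) (y \in S).
  by rewrite inE; case: excluded_middle_informative => ?; constructor.
have [|||d [d_gt0 cardS] fixS] := @finite_subfield F p S charFp.
- by apply/SP; exists 1; rewrite ?rmorph1.
- move=> _ _ /SP[g rep_g <-] /SP[h rep_h <-]; apply/SP; exists (g - h).
    exact/repD/repN.
  by rewrite rmorphB.
- move=> _ _ /SP[g rep_g <-] /SP[h rep_h <-]; apply/SP; exists (g * h).
    exact: repM.
  by rewrite rmorphM.
have Delta_d : contains_system Delta p d.
  pose s (i : 'I_(p ^ d)) := enum_val (cast_ord (esym cardS) i).
  have Ss i : s i \in S by apply: enum_valP.
  apply: (@vanish_contains_system _ _ _ _ F s) => // [i1 i2 /enum_val_inj/cast_ord_inj //|i|x].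
    exact: fixS.
  have /fin_all_exists2[g rep_g Dg] i : inS (s (x i)) by apply/SP.
  by rewrite -[RHS](van g rep_g); apply: meval_eq => i /=.
have [k dv_dk /negP[]] := not_Delta d d_gt0 Delta_d.
apply: (frobenius_mem_periods nu'j) => g rep_g; case/dvdnP: dv_dk => c ->.
set y := zeval _ g; have Sy : y \in S by apply/SP; exists g.
by elim: c => [|c IHc]; rewrite ?expr1 // mulSn expnD exprM fixS.
Qed.

(** If a works for all j < m and b for m, then e a + (1 - e) b works for all j <= m, where
    e = Delta(a)^(q-1) reduces to 1 where Delta(a) is nonzero and to 0 elsewhere. *)
Lemma nonvanishing_everywhere :
    (forall d, (0 < d)%N -> contains_system Delta p d ->
       exists2 k, (d %| k)%N & ~~ (nu %| p ^ (k * #|H|) - 1)%N) ->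
  exists2 g, (forall i : 'I_n, rep (g i))
    & forall j, (0 < j < nu)%N -> (map_mpoly intr Delta).@[zeval (omega ^+ j) \o g] != 0.
Proof.
move=> not_Delta.
suffices: forall m, (m <= nu)%N -> exists2 g, (forall i : 'I_n, rep (g i))
    & forall j, (0 < j < m)%N -> (map_mpoly intr Delta).@[zeval (omega ^+ j) \o g] != 0.
  by apply.
elim=> [|m IHm] le_m; first by exists (fun=> 1) => // j; rewrite ltn0 andbF.
have [a rep_a a_nz] := IHm (ltnW le_m).
have [->|m_gt0] := posnP m; first by exists a => // -[].
have nu'm : ~~ (nu %| m)%N by rewrite gtnNdvd.
have [b rep_b b_nz] := nonvanishing_at nu'm not_Delta.
pose e := (map_mpoly intr Delta).@[a] ^+ #|F|.-1.
have cardF := finNzRing_gt1 F.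
have rep_e : rep e.
  by rewrite /e; elim: (_.-1) => // r IHr; rewrite exprS; apply/repM/IHr/rep_mpoly.
exists (fun i => e * a i + (1 - e) * b i) => [i|j /andP[j_gt0]].
  by apply: repD; apply: repM => //; apply: repD => //; apply: repN.
have eE : zeval (omega ^+ j) e = ((map_mpoly intr Delta).@[zeval (omega ^+ j) \o a] != 0)%:R.
  rewrite rmorphXn /= zeval_mpoly; set y := meval _ _.
  have [->|y0] := eqVneq y 0; first by rewrite expr0n -subn1 subn_eq0 leqNgt cardF.
  by apply: (mulfI y0); rewrite mulr1 -exprS prednK ?expf_card // ltnW.
rewrite ltnS leq_eqVlt.
have valE i : zeval (omega ^+ j) (e * a i + (1 - e) * b i) =
  if (map_mpoly intr Delta).@[zeval (omega ^+ j) \o a] != 0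
  then zeval (omega ^+ j) (a i) else zeval (omega ^+ j) (b i).
  rewrite rmorphD !rmorphM rmorphB rmorph1 /= eE; case: ifP => _.
    by rewrite subrr mul1r mul0r addr0.
  by rewrite subr0 mul0r add0r mul1r.
rewrite (meval_eq (map_mpoly intr Delta) valE); 
case: (boolP ((map_mpoly intr Delta).@[zeval (omega ^+ j) \o a] != 0)) => [nz _ //|/negPn/eqP a0 /orP[/eqP Djm|lt_jm]].
  by rewrite Djm.
by have := a_nz j; rewrite j_gt0 lt_jm a0 eqxx => /(_ isT).
Qed.

(** With D = Delta(a) nonzero at every omega^j, D^(q-1) - 1 = p t with t integral in L; a
    prime ideal containing p and D would contain 1. *)
Lemma supplementary_of_periods :
    (forall d, (0 < d)%N -> contains_system Delta p d ->
       exists2 k, (d %| k)%N & ~~ (nu %| p ^ (k * #|H|) - 1)%N) ->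
  supplementary Delta p L.
Proof.
move=> not_Delta.
have [g /fin_all_exists[a Da] g_nz] := nonvanishing_everywhere not_Delta.
have zeta_int := algint_prim_root zetaP.
exists a => [i|P [P_int [P0 PD] PM P'1 _] Pp PDelta].
  by apply/(algint_fmorph iota); rewrite Da; apply: algint_zeval.
pose D := (map_mpoly intr Delta).@[g].
have DP : iota (map_mpoly intr Delta).@[a] = zeval zeta D.
  by rewrite zeval_mpoly rmorph_mevalZ; apply: meval_eq => i /=.
have q_gt1 := finNzRing_gt1 F.
pose h := D ^+ #|F|.-1 - 1.
have h_root j : (0 < j < nu)%N -> zeval (omega ^+ j) h = 0.
  move/g_nz; rewrite -zeval_mpoly -/D => D_nz; rewrite rmorphB rmorphXn rmorph1 /=.
  apply/eqP; rewrite subr_eq0; apply/eqP/(mulfI D_nz).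
  by rewrite mulr1 -exprS prednK ?expf_card // ltnW.
have [s [t Dh]] := zeval_all_conj charFp omegaP h_root.
pose x := (map_mpoly intr Delta).@[a] : L.
pose z := (x ^+ #|F|.-1 - 1) / p%:R.
have p0 : p%:R != 0 :> Gamma.
  by rewrite -(rmorph_nat (in_alg Gamma)) fmorph_eq0 pnatr_eq0 -lt0n prime_gt0 ?(pcharf_prime charFp).
have Dz : iota z = zeval zeta t.
  rewrite fmorph_div rmorph_nat rmorphB rmorphXn rmorph1 /= DP.
  apply: (canLR (mulfK p0)); rewrite mulrC -(rmorph_nat (zeval zeta)) -rmorphM.
  have:= congr1 (zeval zeta) Dh; rewrite [RHS]rmorphD /= [X in _ = X + _]rmorphM /=.
  rewrite zeval_geom0 // mulr0 add0r => <-.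
  by rewrite rmorphB rmorphXn rmorph1.
have z_int : algint z by apply/(algint_fmorph iota); rewrite Dz; apply: algint_zeval.
apply: P'1.
have x_int : algint x by apply: P_int.
have -> : 1 = x ^+ #|F|.-2 * x + (- z) * p%:R.
  have p0' : p%:R != 0 :> L by rewrite -(fmorph_eq0 iota) rmorph_nat.
  rewrite -exprSr prednK; last by rewrite -subn1 subn_gt0.
  by rewrite /z mulNr divfK // opprB [RHS]addrC subrK.
apply: PD; apply: PM => //; first exact: algintX.
exact: integral_opp.
Qed.

End Construction.

End Supplementary.

(** * Subfields, periods and the theorem *)

Section Subfields.

Variables (nu : nat) (Gamma : fieldExtType rat) (zeta : Gamma).
Hypotheses (nu_pr : prime nu) (zetaP : nu.-primitive_root zeta).
Hypothesis (gen_zeta : <<1; zeta>>%VS = fullv).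

Local Notation qpoly g := (map_poly (in_alg Gamma) g).

Lemma expr_Fp_nat m : zeta ^+ (m%:R : 'F_nu) = zeta ^+ m.
Proof. by rewrite val_Fp_nat // prim_expr_mod. Qed.

Lemma expr_unitM (u v : {unit 'F_nu}) :
  zeta ^+ val (u * v)%g = zeta ^+ (val u * val v).
Proof. by rewrite -[RHS]expr_Fp_nat natrM !natr_Zp. Qed.

Lemma expr_unit_inj : injective (fun u : {unit 'F_nu} => zeta ^+ val u).
Proof.
move=> u v /eqP; rewrite (eq_prim_root_expr zetaP).
have lt_nu (w : {unit 'F_nu}) : (val w < nu)%N.
  by rewrite -[X in (_ < X)%N](Fp_cast nu_pr) ltn_ord.
by rewrite !modn_small // => /eqP eq_uv; do 2!apply: val_inj.
Qed.

Lemma unit_ndvd (u : {unit 'F_nu}) : ~~ (nu %| val u)%N.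
Proof.
rewrite (dvdn_pcharf (pchar_Fp nu_pr)) natr_Zp.
by have := valP u; rewrite unitfE.
Qed.

Lemma dim_cyclotomic : \dim {:Gamma} = nu.-1.
Proof.
rewrite -gen_zeta dim_Fadjoin dimv1 muln1.
apply/eqP; rewrite -eqSS -size_minPoly prednK ?prime_gt0 //.
have geom0 := zeval_geom0 nu_pr zetaP.
rewrite eqn_leq; apply/andP; split.
  have sz : size (map_poly (in_alg Gamma) (map_poly intr (geom_poly nu))) = nu.
    by rewrite size_map_poly size_map_inj_poly ?size_geom //; apply: intr_inj.
  rewrite -[X in (_ <= X)%N]sz; apply: dvdp_leq.
    by rewrite -size_poly_gt0 sz prime_gt0.
  apply: minPoly_dvdp; first exact: alg_polyOver.
  by apply/rootP; rewrite qpoly_int -zevalE.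
have /polyOver1P[g Dg] := minPolyOver 1 zeta.
have := root_minPoly 1 zeta; rewrite Dg size_map_poly => /(geom_rat_dvd nu_pr zetaP).
move/dvdp_leq; rewrite size_map_inj_poly ?size_geom //; last exact: intr_inj.
apply; rewrite -(map_poly_eq0 (in_alg Gamma)) -Dg monic_neq0 //.
exact: monic_minPoly.
Qed.

(** The polynomial g - g(zeta) has coefficients in E and the root zeta, so the minimal
    polynomial of zeta over E divides it. *)
Lemma conj_fixed (E : {subfield Gamma}) r (g : {poly rat}) :
    root (minPoly E zeta) (zeta ^+ r) -> (qpoly g).[zeta] \in E ->
  (qpoly g).[zeta ^+ r] = (qpoly g).[zeta].
Proof.
move=> root_r Eg; apply/eqP; rewrite -subr_eq0.
have: root (qpoly g - (qpoly g).[zeta]%:P) (zeta ^+ r).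
  apply: root_dvdp root_r; apply: minPoly_dvdp.
    apply: rpredB; last by rewrite polyOverC.
    exact: alg_polyOver.
  by rewrite rootE !hornerE subrr.
by rewrite rootE !hornerE.
Qed.

(** The conjugation zeta -> zeta^r, which fixes E, is applied to the relation
    m(zeta^s) = 0 after writing each coefficient of m as a rational polynomial in zeta. *)
Lemma root_minPoly_mul (E : {subfield Gamma}) r s : ~~ (nu %| r)%N ->
    root (minPoly E zeta) (zeta ^+ r) -> root (minPoly E zeta) (zeta ^+ s) ->
  root (minPoly E zeta) (zeta ^+ (s * r)).
Proof.
move=> nu'r root_r root_s; set m := minPoly E zeta.
have /fin_all_exists[c Dc] (i : 'I_(size m)) : exists c, m`_i = (qpoly c).[zeta].
  by apply/Fadjoin1_polyP; rewrite gen_zeta memvf.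
(* M(zeta) = m(zeta^s), the coefficients of m being written as rational polynomials
   in zeta. *)
pose M := \sum_(i < size m) c i * 'X^(s * i).
have ME x : (qpoly M).[x] = \sum_(i < size m) (qpoly (c i)).[x] * x ^+ (s * i).
  rewrite rmorph_sum horner_sum; apply: eq_bigr => i _.
  by rewrite rmorphM /= map_polyXn hornerM hornerXn.
have: root (qpoly M) zeta.
  move: root_s; rewrite !rootE ME horner_coef; apply: etrans; congr (_ == 0).
  by apply: eq_bigr => i _; rewrite -Dc exprM.
move/(rat_conj_root nu_pr zetaP nu'r); rewrite !rootE ME horner_coef.
apply: etrans; congr (_ == 0); apply: eq_bigr => i _.
rewrite (conj_fixed root_r) -?Dc; last by rewrite (polyOverP _) ?minPolyOver.
by rewrite -!exprM; congr (_ * _ ^+ _); lia.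
Qed.

Lemma geom_split : map_poly intr (geom_poly nu) =
  \prod_(u <- enum [set: {unit 'F_nu}]) ('X - (zeta ^+ val (u : {unit 'F_nu}))%:P).
Proof.
have geom_mon : map_poly (intr : int -> Gamma) (geom_poly nu) \is monic.
  by rewrite monic_map ?monic_geom ?prime_gt0.
rewrite [LHS](@all_roots_prod_XsubC _ _ [seq zeta ^+ val (u : {unit 'F_nu}) | u <- enum [set: {unit 'F_nu}]]).
- by rewrite (monicP geom_mon) scale1r big_map.
- rewrite size_map_poly_id0 ?size_geom; last first.
    by rewrite (monicP (monic_geom (prime_gt0 nu_pr))) oner_neq0.
  by rewrite size_map -cardE card_finField_unit card_Fp // prednK ?prime_gt0.
- apply/allP=> _ /mapP[u _ ->]; apply/rootP.
  by rewrite -zevalE (geom_root zetaP) ?unit_ndvd.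
by rewrite uniq_rootsE map_inj_uniq ?enum_uniq //; apply: expr_unit_inj.
Qed.

(** The exponents u for which zeta^u is a root of the minimal polynomial of zeta over E
    form a subgroup of order [Q(zeta) : E] (the Galois group over E); in a cyclic group
    it contains every element whose order divides its own. *)
Lemma minPoly_root_unit (E : {subfield Gamma}) (u : {unit 'F_nu}) :
    (u ^+ adjoin_degree E zeta = 1)%g -> root (minPoly E zeta) (zeta ^+ val u).
Proof.
set m := minPoly E zeta => u_exp.
have geom_m : m %| \prod_(v <- enum [set: {unit 'F_nu}]) ('X - (zeta ^+ val (v : {unit 'F_nu}))%:P).
  rewrite -geom_split -qpoly_int; apply: minPoly_dvdp; first exact: alg_polyOver.
  by apply/rootP; rewrite qpoly_int -zevalE zeval_geom0.
have [b Dm] := dvdp_prod_XsubC geom_m.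
pose S := [set v : {unit 'F_nu} | root m (zeta ^+ val v)].
have gS : group_set S.
  apply/group_setP; split=> [|v w].
    by rewrite inE -[val _]/(1%R : 'F_nu) (expr_Fp_nat 1) expr1 root_minPoly.
  rewrite !inE expr_unitM => m_v m_w; rewrite root_minPoly_mul ?unit_ndvd //.
have cardS : #|S| = adjoin_degree E zeta.
  set t := mask b _ in Dm; apply: succn_inj; rewrite -size_minPoly -/m.
  rewrite (eqp_size Dm) size_prod_XsubC -(card_uniqP _) ?mask_uniq ?enum_uniq //.
  congr _.+1; apply: eq_card => v; rewrite inE (eqp_root Dm).
  rewrite -(big_map (fun v : {unit 'F_nu} => zeta ^+ val v) xpredT
    (fun x => 'X - x%:P)).
  by rewrite root_prod_XsubC; exact: (mem_map expr_unit_inj).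
have cyc : cyclic [set: {unit 'F_nu}] := field_unit_group_cyclic _.
have: <[u]>%g \subset Group gS.
  rewrite -(cardSg_cyclic cyc) ?subsetT //= cardS -orderE.
  by rewrite order_dvdn u_exp.
by move/subsetP/(_ u (cycle_id u)); rewrite inE.
Qed.

Lemma zeval_fixed_subfield (E : {subfield Gamma}) r mu (g : {poly int}) :
    (mu * \dim E = nu - 1)%N -> (0 < r)%N -> (nu %| r ^ mu - 1)%N ->
    zeval zeta g \in E -> zeval (zeta ^+ r) g = zeval zeta g.
Proof.
move=> Dmu r_gt0 r_mu; have dimE_gt0 : (0 < \dim E)%N := adim_gt0 E.
have adjE : adjoin_degree E zeta = mu.
  apply/eqP; rewrite -(eqn_pmul2r dimE_gt0) -dim_Fadjoin Dmu subn1 -dim_cyclotomic.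
  suffices /eqP-> : <<E; zeta>>%VS == fullv by [].
  by rewrite eqEsubv subvf -gen_zeta adjoinSl ?sub1v.
have r_exp : r%:R ^+ mu = 1 :> 'F_nu.
  by apply/eqP; rewrite -natrX -dvdn_sub1_Fp // expn_gt0 r_gt0.
have mu_gt0 : (0 < mu)%N.
  by case: mu Dmu {adjE r_mu r_exp} => //; have := prime_gt1 nu_pr; lia.
have r_unit : (r%:R : 'F_nu) \is a GRing.unit.
  rewrite unitfE; apply: contra_eq_neq r_exp => ->.
  by rewrite expr0n gtn_eqF //= eq_sym oner_neq0.
have r_root : root (minPoly E zeta) (zeta ^+ r).
  rewrite -expr_Fp_nat; apply: (@minPoly_root_unit E (FinRing.unit 'F_nu r_unit)).
  by apply: val_inj; rewrite adjE FinRing.val_unitX /= r_exp.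
by rewrite !zevalE -!qpoly_int; apply: conj_fixed.
Qed.

(** For t prime to nu this is the period attached to the coset H t; for the other t it is
    the order of H. *)
Lemma period_field_periods (H : {group {unit 'F_nu}}) t :
  exists x : subvs_of (period_field zeta H),
    vsval x = \sum_(u in H) zeta ^+ (val u * t).
Proof.
have [nu_t|nu't] := boolP (nu %| t)%N.
  exists #|H|%:R; rewrite rmorph_nat -sumr_const; apply: eq_bigr => u _.
  by apply/esym/eqP; rewrite -(prim_order_dvd zetaP) dvdn_mull.
have t_unit : (t%:R : 'F_nu) \is a GRing.unit.
  by rewrite unitfE -(dvdn_pcharf (pchar_Fp nu_pr)).
pose v := FinRing.unit 'F_nu t_unit.
have Ev : gauss_period zeta (H :* v)%g \in period_field zeta H.
  apply: seqv_sub_adjoin; apply: map_f; rewrite mem_enum.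
  by apply/rcosetsP; exists v; rewrite ?inE.
exists (Subvs Ev); rewrite /= /gauss_period -rcosetE big_imset /=; last first.
  by move=> x y _ _; apply: mulIg.
apply: eq_bigr => u _; rewrite [LHS](expr_unitM u v).
by rewrite ![(val u * _)%N]mulnC !exprM expr_Fp_nat.
Qed.

End Subfields.

Theorem mainTheorem18
  (K : fieldExtType rat) (n : nat) (degK : \dim {:K} = n)
  (xi : 'I_n -> K) (basis_xi : integral_basis xi)
  (sigma : 'I_n -> {rmorphism K -> algC}) (all_sigma : all_embeddings sigma)
  (Delta : {mpoly int[n]}) (Delta_form : index_form xi sigma Delta)
  (p : nat) (p_prime : prime p)
  (ks : seq nat) (ks_max : maximal_systems Delta p ks)
  (nu : nat) (nu_prime : prime nu) (nu_neq_p : nu <> p)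
  (nu_ndvd : ~~ (nu %| Fval ks p)%N)
  (nu_min : forall q : nat, prime q -> q <> p -> ~~ (q %| Fval ks p)%N -> (nu <= q)%N)
  (Gamma : fieldExtType rat) (zeta : Gamma)
  (Gamma_nu : cyclotomic_field nu zeta) :
  (* If p = 2 and Delta contains no P_k, then nu = 3 while the field of square
     roots of unity, Q, is already supplementary. *)
  (supplementary Delta p Gamma /\
   ((p = 2%N -> ks <> [::]) ->
    forall nu1 : nat, prime nu1 -> (nu1 < nu)%N ->
    forall (Gamma1 : fieldExtType rat) (zeta1 : Gamma1),
      cyclotomic_field nu1 zeta1 -> ~ supplementary Delta p Gamma1))
  /\
  (forall lambda mu : nat, (lambda * mu = nu - 1)%N ->
   ~~ (nu %| Fval ks (p ^ mu))%N ->
   (forall mu' : nat, (mu' %| nu - 1)%N -> ~~ (nu %| Fval ks (p ^ mu'))%N ->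
      (mu' <= mu)%N) ->
   forall H : {group {unit 'F_nu}}, #|H| = mu ->
     supplementary Delta p (subvs_of (period_field zeta H)) /\
     (forall E : {subfield Gamma}, (\dim E < lambda)%N ->
        ~ supplementary Delta p (subvs_of E))).
Proof.
have [_ prim_Delta _] := Delta_form; have [zetaP gen_zeta] := Gamma_nu.
have [F [omega [charFp omegaP]]] := finite_field_prim_root p_prime nu_prime nu_neq_p.
have geom0 : zeval omega (geom_poly nu) = 0 by apply: zeval_geom0.
have ks_contains k : k \in ks -> contains_system Delta p k by case/(proj2 ks_max).
have not_in_Delta m : ~~ (nu %| Fval ks (p ^ m))%N ->
    forall d, (0 < d)%N -> contains_system Delta p d ->
  exists2 k, (d %| k)%N & ~~ (nu %| p ^ (k * m) - 1)%N.
  rewrite Fval_dvd // => /hasPn ks_m d d_gt0 Delta_d.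
  have [k ks_k dv_dk] := contains_system_maximal p_prime prim_Delta ks_max d_gt0 Delta_d.
  by exists k => //; have := ks_m k ks_k; rewrite -expnM mulnC.
split; [split |].
- apply: (supplementary_of_periods nu_prime zetaP (iota := idfun) charFp
    omegaP nu_neq_p (H := 1%G)) => [t|].
    by exists (zeta ^+ t); rewrite big_set1 mul1n.
  by apply: not_in_Delta; rewrite cards1 expn1.
- move=> ks_p2 nu1 nu1_pr lt_nu1 Gamma1 zeta1 [zeta1P gen_zeta1].
  (* With no P_k in Delta and p odd, nu = 2 and no prime is smaller. *)
  have ks_neq0 : ks <> [::].
    move=> ks0; have [p2|p2] := eqVneq p 2; first exact: ks_p2.
    suffices: (nu <= 2)%N by rewrite leqNgt (leq_ltn_trans (prime_gt1 nu1_pr)).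
    by apply: nu_min; rewrite // ?ks0 /Fval ?big_nil //; apply/eqP; rewrite eq_sym.
  have [nu1_p|/eqP ne_nu1_p] := eqVneq nu1 p.
    have [k ks_k] : exists k, k \in ks.
      by move: ks_neq0; case: (ks) => // k ks' _; exists k; rewrite mem_head.
    apply: (not_supplementary nu1_pr zeta1P gen_zeta1 (iota := idfun)
      (omega := 1) (pchar_Fp p_prime) _ (ks_contains k ks_k)) => [|x g _].
      rewrite zeval_geom; under eq_bigr do rewrite expr1n.
      by rewrite sumr_const card_ord nu1_p pchar_Fp_0.
    by rewrite zeval_frobenius ?pchar_Fp // expr1n.
  have /hasP[k ks_k nu1_k] : has (fun k => nu1 %| p ^ k - 1)%N ks.
    rewrite -Fval_dvd //; apply: contraLR lt_nu1 => nu1_ndvd.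
    by rewrite -leqNgt nu_min.
  have [F1 [omega1 [charF1 omega1P]]] := finite_field_prim_root p_prime nu1_pr ne_nu1_p.
  apply: (not_supplementary nu1_pr zeta1P gen_zeta1 (iota := idfun)
    (omega := omega1) charF1 _ (ks_contains k ks_k)) => [|x g _].
    exact: zeval_geom0.
  rewrite zeval_frobenius //; congr (zeval _ g).
  rewrite -[in LHS](subnK (_ : 0 < p ^ k)%N) ?expn_gt0 ?prime_gt0 // exprD expr1.
  by move: nu1_k; rewrite (prim_order_dvd omega1P) => /eqP->; rewrite mul1r.
move=> lambda mu Dnu F_mu mu_max H cardH; split.
  apply: (supplementary_of_periods nu_prime zetaP (iota := vsval) charFp
    omegaP nu_neq_p (H := H)) => [t|]; first exact: period_field_periods.
  by rewrite cardH; apply: not_in_Delta.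
move=> E lt_E; pose mu' := (\dim {:Gamma} %/ \dim E)%N.
have Dmu' : (mu' * \dim E = nu - 1)%N.
  by rewrite subn1 -(dim_cyclotomic nu_prime zetaP gen_zeta) divnK ?field_dimS ?subvf.
have nu1_gt0 : (0 < nu - 1)%N by rewrite subn_gt0 prime_gt1.
have lt_mu : (mu < mu')%N.
  have mu_gt0 : (0 < mu)%N by move: nu1_gt0; rewrite -Dnu muln_gt0 => /andP[].
  rewrite ltnNge; apply/negP=> le_mu'; move: (leqnn (nu - 1)%N).
  rewrite -{1}Dnu -Dmu' leqNgt (leq_ltn_trans (leq_mul le_mu' (leqnn _))) //.
  by rewrite mulnC ltn_pmul2r.
have /hasP[k ks_k nu_k] : has (fun k => nu %| (p ^ mu') ^ k - 1)%N ks.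
  rewrite -Fval_dvd //; apply: contraLR lt_mu => nu_mu'.
  by rewrite -leqNgt mu_max // -Dmu' dvdn_mulr.
apply: (not_supplementary nu_prime zetaP gen_zeta (iota := vsval) charFp geom0
  (ks_contains k ks_k)) => x g Dx.
rewrite zeval_frobenius // -zevalXn -zeval_comp.
apply: (zeval_reduction nu_prime zetaP geom0); rewrite zeval_comp zevalXn.
apply: (zeval_fixed_subfield nu_prime zetaP gen_zeta Dmu'); rewrite ?expn_gt0 ?prime_gt0 //.
  by rewrite -expnM mulnC expnM.
by rewrite -Dx subvsP.
Qed.
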